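(* Let $A\in\mathbb{R}^{n\times n}$ be symmetric positive semi-definite with eigendecomposition $A=U\Lambda U^\top$, where $U=[u_1,\ldots,u_n]$ is orthogonal and $\Lambda=\mathrm{diag}(\lambda_1,\ldots,\lambda_n)$ with $\lambda_1\ge\cdots\ge\lambda_n\ge0$ (so $\lambda_j=\lambda_j(A)$). Let $1\le k<n$, $U_1=[u_1,\ldots,u_k]$, $U_2=[u_{k+1},\ldots,u_n]$, and let $0\le\epsilon<1$. Suppose $Q\in\mathbb{R}^{n\times k}$ has orthonormal columns ($Q^\top Q=I_k$) and \[ Q=U_1+\epsilon^2U_1M+\epsilon U_2N \] for some $M\in\mathbb{R}^{k\times k}$, $N\in\mathbb{R}^{(n-k)\times k}$ with $\|M\|_2\le1$, $\|N\|_2\le1$. For $i=1,\ldots,k$ define \[ \alpha_i:=1-\frac{3\lambda_{k+1}+3\epsilon^2(\lambda_1-\lambda_{k+1})}{\lambda_i}. \] Then for each $i=1,\ldots,k$ with $\alpha_i>0$: \[ |\lambda_i-\sigma_i(AQ)|\le|\lambda_i-\lambda_i(Q^\top AQ)|\le C_{RR}\,\epsilon^2\lambda_1, \] \[ \bigl|\lambda_i-\lambda_i\bigl(AQ(Q^\top AQ)^{\dagger}(AQ)^\top\bigr)\bigr|\le C_{Nys,i}\bigl(\epsilon^2\lambda_{k+1}+\epsilon^4(\lambda_1-\lambda_{k+1})\bigr), \] where $C_{RR}:=2+\epsilon^2+\lambda_{k+1}/\lambda_1\le4$ and \[ C_{Nys,i}:=\left(\frac{\lambda_1(1+\epsilon^2)+\lambda_{k+1}\Bigl(1+\frac{\epsilon^2}{1+\sqrt{1-\epsilon^2}}\Bigr)}{\alpha_i\lambda_i}\right)^{2}.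 \]
   Context: $\|\cdot\|_2$ is the spectral norm. For a symmetric matrix $B$, $\lambda_i(B)$ denotes its $i$-th largest eigenvalue; $\sigma_i(B)$ denotes the $i$-th largest singular value of a matrix $B$; $B^{\dagger}$ is the Moore–Penrose pseudoinverse. The quantities $\lambda_i(Q^\top AQ)$, $\sigma_i(AQ)$ and $\lambda_i(AQ(Q^\top AQ)^{\dagger}(AQ)^\top)$ are the Rayleigh–Ritz, SVD-extract and Nyström eigenvalue estimates, respectively. (Implicitly $\lambda_1>0$ so that $C_{RR}$ is defined.) *)

(* Defs.v *)
From HB Require Import structures.
From mathcomp Require Import all_boot all_order all_algebra.
From Stdlib Require Import ClassicalEpsilon.
Set Implicit Arguments. Unset Strict Implicit. Unset Printing Implicit Defensive.
Import Order.TTheory GRing.Theory Num.Theory.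
Local Open Scope ring_scope.

Section Defs.
Variable R : rcfType.

(* The eigenvalues of a square matrix B, listed in decreasing order with
   multiplicity: the (unique) nonincreasing sequence s whose linear factors
   multiply to the characteristic polynomial of B.  For a real symmetric
   matrix such a sequence exists. *)
Definition eigvals (p : nat) (B : 'M[R]_p) : seq R :=
  epsilon (inhabits [::])
    (fun s : seq R => sorted (fun x y => y <= x) s /\
       char_poly B = \prod_(x <- s) ('X - x%:P)).

(* lambda_{i+1}(B): the (i+1)-th largest eigenvalue (0-based index i). *)
Definition eigval (p : nat) (B : 'M[R]_p) (i : nat) : R := nth 0 (eigvals B) i.

(* sigma_{i+1}(B): the (i+1)-th largest singular value (0-based index i),
   i.e. the square root of the (i+1)-th largest eigenvalue of B^T B. *)
Definition singval (p q : nat) (B : 'M[R]_(p, q)) (i : nat) : R :=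
  Num.sqrt (eigval (B^T *m B) i).

Definition specnorm (p q : nat) (B : 'M[R]_(p, q)) : R := singval B 0.

Definition is_pinv (p q : nat) (B : 'M[R]_(p, q)) (X : 'M[R]_(q, p)) : Prop :=
  [/\ B *m X *m B = B, X *m B *m X = X, (B *m X)^T = B *m X & (X *m B)^T = X *m B].

Definition mpinv (p q : nat) (B : 'M[R]_(p, q)) : 'M[R]_(q, p) :=
  epsilon (inhabits 0) (is_pinv B).

End Defs.

Lemma shift_ord_proof (n k : nat) (j : 'I_(n - k)) : (k + j < n)%N.
Proof. by rewrite -ltn_subRL. Qed.

Definition shift_ord (n k : nat) (j : 'I_(n - k)) : 'I_n :=
  Ordinal (shift_ord_proof j).

Definition firstcols (R : rcfType) (n k : nat) (hk : (k <= n)%N) (U : 'M[R]_n)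
  : 'M[R]_(n, k) := colsub (widen_ord hk) U.
Definition lastcols (R : rcfType) (n k : nat) (U : 'M[R]_n) : 'M[R]_(n, n - k) :=
  colsub (@shift_ord n k) U.

(* Main.v *)
(* Every eigenvalue comparison is an instance of Courant-Fischer with an explicit
   trial subspace: span of Q W (W the Ritz vectors) for the upper bounds, the first
   coordinate vectors for the Rayleigh-Ritz lower bound, and the leading
   eigenvectors of A for the Nystrom lower bound.

   The singular-value bound follows from (Q^T A Q)^2 <= Q^T A^2 Q, which holds
   since Q Q^T <= I.

   For Nystrom, A - A_nys is the form x |-> min_z (x - Q z)^T A (x - Q z).  With
   x = U_1 a and z = Q^T x, the residual has squared norm at most eps^2 |a|^2 and
   its component along U_1 has squared norm at most eps^4 |a|^2, which yields the
   error eps^2 lam_{k+1} + eps^4 (lam_1 - lam_{k+1}) with constant 1; the stated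
   constant C_Nys is at least 1. *)
Require Import Defs.
From HB Require Import structures.
From mathcomp Require Import all_boot all_order all_algebra all_fingroup.
From mathcomp Require Import complex ring lra.
From Stdlib Require Import ClassicalEpsilon.
Import Order.TTheory GRing.Theory Num.Theory.
Local Open Scope ring_scope.

(** * Spectral theorem for symmetric matrices over a real closed field *)

(** Over [R[i]] the matrix is Hermitian, so its spectral diagonal is real. Any entry of that
    diagonal is a root of the characteristic polynomial, whose coefficients lie in [R], so the root
    descends to [R]. *)
Lemma sym_eigenvalue (R : rcfType) (p : nat) (B : 'M[R]_p) :
  (0 < p)%N -> B^T = B -> exists a, eigenvalue B a.
Proof.
move=> p_gt0 B_sym.
pose B' := map_mx (real_complex R) B.
have B'_herm : B' \is hermsymmx.
  apply: realsym_hermsym.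
    by apply/is_hermitianmxP; rewrite expr0 scale1r map_mx_id // map_trmx B_sym.
  by apply/mxOverP => i j; rewrite mxE complex_real.
have /mxOverP/(_ 0 (Ordinal p_gt0))/complex_realP[a a_diag] :=
  hermitian_spectral_diag_real B'_herm.
exists a; rewrite eigenvalue_root_char -(fmorph_root (real_complex R)).
rewrite map_char_poly -eigenvalue_root_char.
suff: eigenvalue B' (spectral_diag B' 0 (Ordinal p_gt0)) by rewrite a_diag.
have /orthomx_spectralP B'_eq := hermitian_normalmx B'_herm.
apply/eigenvalueP; exists (row (Ordinal p_gt0) (spectralmx B')).
  rewrite {2}B'_eq -row_mul !mulmxA mulmxV ?spectral_unit // mul1mx.
  by rewrite row_mul row_diag_mx -scalemxAl -rowE.
rewrite rowE; apply/eqP => /(congr1 (mulmx^~ (invmx (spectralmx B')))).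
rewrite mul0mx mulmxK ?spectral_unit // => /matrixP/(_ 0 (Ordinal p_gt0)).
by rewrite !mxE !eqxx /= => /eqP; rewrite oner_eq0.
Qed.

Lemma sum_sqr_gt0 (R : realFieldType) (p : nat) (x : 'cV[R]_p) :
  x != 0 -> 0 < (x^T *m x) 0 0.
Proof.
move=> x_neq0; rewrite mxE; have sq_ge0 i : 0 <= x^T 0 i * x i 0.
  by rewrite mxE -expr2 sqr_ge0.
rewrite lt_neqAle sumr_ge0 // andbT eq_sym; apply: contra x_neq0.
rewrite psumr_eq0 // => /allP x0; apply/eqP/colP => i; rewrite mxE.
by have := x0 i (mem_index_enum i); rewrite mxE mulf_eq0 orbb => /eqP.
Qed.

(** The reflection $1 - 2ww^T/|w|^2$ with $w = v - e$ exchanges the unit vectors $v$ and $e$; for $w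
    = 0$ the identity serves. *)
Lemma householder (R : rcfType) (p : nat) (v : 'cV[R]_p.+1) :
  v^T *m v = 1%:M ->
  exists H : 'M[R]_p.+1, [/\ H^T = H, H *m H = 1%:M & H *m v = delta_mx 0 0].
Proof.
move=> v1; pose e : 'cV[R]_p.+1 := delta_mx 0 0; pose w := v - e.
have [w0|w_neq0] := eqVneq w 0.
  exists 1%:M; split; rewrite ?trmx1 ?mul1mx //.
  by apply/eqP; rewrite -subr_eq0; apply/eqP.
have := sum_sqr_gt0 _ _ _ w_neq0; set s := (w^T *m w) 0 0 => s_gt0.
have ww : w^T *m w = s%:M by rewrite [LHS]mx11_scalar.
have e1 : e^T *m e = 1%:M.
  by rewrite /e trmx_delta mul_delta_mx; apply/matrixP => i j; rewrite !ord1 !mxE.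
have ev : e^T *m v = v^T *m e.
  by rewrite -[LHS]trmxK trmx_mul trmxK; apply/matrixP => i j; rewrite !ord1 !mxE;
    apply: eq_bigr => l _; rewrite !mxE.
(* Since $|v| = |e| = 1$, both $|w|^2$ and $2w^Tv$ equal $2 - 2e^Tv$. *)
have wv : w^T *m v = (s / 2)%:M.
  have : s%:M = w^T *m v *+ 2.
    have wT : w^T = v^T - e^T by rewrite /w linearB.
    rewrite -ww {2}/w mulmxBr wT !mulmxBl v1 e1 ev.
    by rewrite mulr2n opprB addrA addrAC.
  move=> /(congr1 (fun X : 'M_1 => 2^-1 *: X)).
  rewrite -scaler_nat scalerA mulVf ?pnatr_eq0 // scale1r => <-.
  by rewrite scale_scalar_mx mulrC.
have s_neq0 : s != 0 by rewrite gt_eqF.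
exists (1%:M - (2 / s) *: (w *m w^T)); split.
- by rewrite linearB /= trmx1 linearZ /= trmx_mul trmxK.
- rewrite mulmxBl mul1mx mulmxBr mulmx1 -!scalemxAl -!scalemxAr.
  rewrite mulmxA -[w *m w^T *m w]mulmxA ww mul_mx_scalar -scalemxAl !scalerA.
  have -> : 2 / s * (2 / s * s) = 2 / s + 2 / s by field.
  by rewrite scalerDl opprB addrK subrK.
- rewrite mulmxBl mul1mx -scalemxAl -mulmxA wv mul_mx_scalar scalerA.
  have -> : 2 / s * (s / 2) = 1 by field.
  by rewrite scale1r /w opprB addrC subrK.
Qed.

(** Deflation: conjugating by the reflection that sends a unit eigenvector to the first coordinate
    vector clears the first column off the diagonal. Symmetry clears the first row, and induction
    applies to the remaining block. *)
Lemma sym_spectral (R : rcfType) (p : nat) (B : 'M[R]_p) :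
  B^T = B -> exists (V : 'M[R]_p) (d : 'rV[R]_p),
    V^T *m V = 1%:M /\ B = V *m diag_mx d *m V^T.
Proof.
elim: p B => [|p IHp] B B_sym.
  by exists 1%:M, 0; split; apply/matrixP => -[].
have [a /eigenvalueP[u uB u_neq0]] := sym_eigenvalue _ _ _ (ltn0Sn p) B_sym.
pose x : 'cV[R]_p.+1 := u^T.
have x_neq0 : x != 0 by apply: contra u_neq0 => /eqP/(congr1 trmx); rewrite trmxK trmx0 => ->.
have Bx : B *m x = a *: x by rewrite -[B]B_sym -trmx_mul uB linearZ.
have := sum_sqr_gt0 _ _ _ x_neq0; set s := (x^T *m x) 0 0 => s_gt0.
pose v : 'cV[R]_p.+1 := (Num.sqrt s)^-1 *: x.
have v1 : v^T *m v = 1%:M.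
  have -> : v^T = (Num.sqrt s)^-1 *: x^T by rewrite /v linearZ.
  rewrite -scalemxAl -scalemxAr scalerA -invfM -expr2.
  by rewrite sqr_sqrtr ?ltW // [X in _ *: X]mx11_scalar scale_scalar_mx mulVf ?gt_eqF.
have Bv : B *m v = a *: v by rewrite -scalemxAr Bx !scalerA mulrC.
have [H [H_sym HH Hv]] := householder _ _ _ v1.
have He : H *m delta_mx 0 0 = v by rewrite -Hv mulmxA HH mul1mx.
pose C : 'M[R]_(1 + p) := H *m B *m H.
have C_sym : C^T = C by rewrite /C !trmx_mul H_sym B_sym mulmxA.
have C0 i : C i (lshift p 0) = a * (i == 0)%:R.
  have -> : lshift p 0 = 0 :> 'I_(1 + p) by apply: val_inj.
  have /matrixP/(_ i 0) : C *m delta_mx 0 0 = a *: (delta_mx 0 0 : 'cV[R]_p.+1).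
    by rewrite /C -!mulmxA He Bv -scalemxAr Hv.
  by rewrite -colE !mxE andbT.
have CD : C = H *m B *m H by [].
clearbody C; pose C' := drsubmx C.
have CE : C = block_mx a%:M 0 0 C'.
  rewrite -[LHS]submxK; congr (block_mx _ _ _ _); apply/matrixP => i j.
  - by rewrite !mxE !ord1 C0 mulr1.
  - by rewrite !mxE !ord1 -C_sym mxE C0 mulr0.
  - by rewrite !mxE !ord1 C0 mulr0.
have C'_sym : C'^T = C' by rewrite /C' trmx_drsub C_sym.
have [V' [d' [V'1 C'E]]] := IHp C' C'_sym.
pose W : 'M[R]_(1 + p) := block_mx 1%:M 0 0 V'.
have WT : W^T = block_mx 1%:M 0 0 V'^T by rewrite /W tr_block_mx !trmx0 trmx1.
have W1 : W^T *m W = 1%:M.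
  rewrite WT /W mulmx_block !(mulmx0, mul0mx, mul1mx, addr0, add0r) V'1.
  by rewrite -scalar_mx_block.
have WdW : W *m diag_mx (row_mx a%:M d') *m W^T = C.
  rewrite WT CE /W diag_mx_row !mulmx_block.
  rewrite !(mulmx0, mul0mx, mul1mx, mulmx1, addr0, add0r) -C'E.
  congr (block_mx _ _ _ _); apply/matrixP => i j; rewrite !ord1 !mxE.
  by rewrite eqxx.
exists (H *m W), (row_mx a%:M d'); split.
  by rewrite trmx_mul H_sym -mulmxA [H *m (H *m W)]mulmxA HH mul1mx.
rewrite trmx_mul H_sym mulmxA -[H *m W *m _ *m _]mulmxA -[H *m W *m _]mulmxA.
by rewrite [W *m (_ *m _)]mulmxA WdW CD !mulmxA HH mul1mx -mulmxA HH mulmx1.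
Qed.

Lemma char_poly_orth (R : comUnitRingType) (p : nat) (V : 'M[R]_p) (d : 'rV[R]_p) :
  V^T *m V = 1%:M ->
  char_poly (V *m diag_mx d *m V^T) = \prod_(j < p) ('X - (d 0 j)%:P).
Proof.
move=> V1; rewrite /char_poly /char_poly_mx; set Vp := map_mx polyC V.
have Vp1 : Vp *m Vp^T = 1%:M.
  by rewrite map_trmx -map_mxM (mulmx1C V1) map_mx1.
have -> : 'X%:M - map_mx polyC (V *m diag_mx d *m V^T) =
          Vp *m ('X%:M - map_mx polyC (diag_mx d)) *m Vp^T.
  by rewrite mulmxBr mulmxBl mul_mx_scalar -scalemxAl Vp1 scalemx1 !map_mxM map_trmx.
rewrite !det_mulmx mulrAC -det_mulmx Vp1 det1 mul1r -[\det _]/(char_poly _).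
rewrite char_poly_trig ?diag_mx_is_trig //.
by apply: eq_bigr => j _; rewrite mxE eqxx.
Qed.

(** Sorting the diagonal of some diagonalization shows that the choice in [eigvals] has a witness.
    The chosen list has the same linear factors, hence is a permutation [q] of that diagonal, and
    permuting the columns of [V] by [q] matches the two. *)
Lemma eigval_spectral (R : rcfType) (p : nat) (B : 'M[R]_p) :
  B^T = B -> exists V : 'M[R]_p, [/\ V^T *m V = 1%:M,
    B = V *m diag_mx (\row_j eigval B j) *m V^T &
    forall i j : nat, (i <= j)%N -> (j < p)%N -> eigval B j <= eigval B i].
Proof.
move=> B_sym; have [V [d [V1 BE]]] := sym_spectral _ _ _ B_sym.
have cpB : char_poly B = \prod_(x <- codom (fun j => d 0 j)) ('X - x%:P).
  by rewrite BE char_poly_orth // big_map big_enum.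
have [|] := epsilon_spec (inhabits [::])
    (fun s : seq R => sorted (fun x y => y <= x) s /\
       char_poly B = \prod_(x <- s) ('X - x%:P)).
  exists (sort (fun x y : R => y <= x) (codom (fun j => d 0 j))); split.
    by apply: sort_sorted => x y; rewrite orbC le_total.
  by rewrite cpB; apply/esym/perm_big; rewrite perm_sort.
rewrite -/(eigvals B) => s_sorted s_cp.
have /tuple_permP[q sE] : perm_eq (eigvals B) [tuple d 0 j | j < p].
  by apply: prod_XsubC_eq; rewrite -s_cp cpB.
have s_size : size (eigvals B) = p by rewrite sE size_tuple.
have eigE (j : 'I_p) : eigval B j = d 0 (q j).
  by rewrite /eigval {1}sE -tnth_nth tnth_mktuple tnth_mktuple.
exists (\matrix_(i, j) V i (q j)); split.
- apply/matrixP => i j; rewrite !mxE.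
  move/matrixP: V1 => /(_ (q i) (q j)); rewrite !mxE (inj_eq perm_inj) => <-.
  by apply: eq_bigr => l _; rewrite !mxE.
- rewrite [in LHS]BE; apply/matrixP => i j.
  rewrite !mul_mx_diag !mxE (reindex_inj (@perm_inj _ q)).
  by apply: eq_bigr => l _; rewrite !mxE eigE.
- move=> i j le_ij lt_jp.
  apply: (sorted_leq_nth (leT := fun x y : R => y <= x)); rewrite ?inE ?s_size //.
  + by move=> x y z xy yz; apply: le_trans yz xy.
  + exact: leq_ltn_trans le_ij lt_jp.
Qed.

(** * Squared norms, quadratic forms and isometries *)

Definition sqnorm {R : rcfType} {p : nat} (x : 'cV[R]_p) : R := (x^T *m x) 0 0.

Definition qform {R : rcfType} {p : nat} (B : 'M[R]_p) (x : 'cV[R]_p) : R :=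
  (x^T *m B *m x) 0 0.

Lemma sqnormE (R : rcfType) (p : nat) (x : 'cV[R]_p) :
  sqnorm x = \sum_(j < p) x j 0 ^+ 2.
Proof. by rewrite /sqnorm mxE; apply: eq_bigr => j _; rewrite mxE. Qed.

Lemma sqnorm_ge0 (R : rcfType) (p : nat) (x : 'cV[R]_p) : 0 <= sqnorm x.
Proof. by rewrite sqnormE sumr_ge0 // => j _; rewrite sqr_ge0. Qed.

Lemma sqnorm_mul (R : rcfType) (p q : nat) (F : 'M[R]_(p, q)) (x : 'cV[R]_q) :
  sqnorm (F *m x) = qform (F^T *m F) x.
Proof. by rewrite /sqnorm /qform trmx_mul !mulmxA. Qed.

Lemma qform1 (R : rcfType) (p : nat) (x : 'cV[R]_p) : qform 1%:M x = sqnorm x.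
Proof. by rewrite /qform mulmx1. Qed.

Lemma sqnorm_isometry (R : rcfType) (p q : nat) (F : 'M[R]_(p, q)) (x : 'cV[R]_q) :
  F^T *m F = 1%:M -> sqnorm (F *m x) = sqnorm x.
Proof. by move=> F1; rewrite sqnorm_mul F1 qform1. Qed.

Lemma qform_mul (R : rcfType) (p q : nat) (B : 'M[R]_p) (F : 'M[R]_(p, q))
  (x : 'cV[R]_q) : qform B (F *m x) = qform (F^T *m B *m F) x.
Proof. by rewrite /qform trmx_mul !mulmxA. Qed.

Lemma qformB (R : rcfType) (p : nat) (B C : 'M[R]_p) (x : 'cV[R]_p) :
  qform (B - C) x = qform B x - qform C x.
Proof. by rewrite /qform mulmxBr mulmxBl !mxE. Qed.

Lemma qform_diag (R : rcfType) (p : nat) (V : 'M[R]_p) (d : 'rV[R]_p)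
  (x : 'cV[R]_p) :
  qform (V *m diag_mx d *m V^T) x = \sum_(j < p) d 0 j * (V^T *m x) j 0 ^+ 2.
Proof.
have -> : qform (V *m diag_mx d *m V^T) x =
    ((V^T *m x)^T *m diag_mx d *m (V^T *m x)) 0 0.
  by rewrite /qform trmx_mul trmxK !mulmxA.
rewrite mxE; apply: eq_bigr => j _; rewrite mul_mx_diag mxE [X in X * _ * _]mxE.
by rewrite expr2 mulrAC mulrC.
Qed.

Lemma qform_spectral (R : rcfType) (p : nat) (V : 'M[R]_p) (b : nat -> R)
  (x : 'cV[R]_p) :
  qform (V *m diag_mx (\row_(j < p) b j) *m V^T) x =
  \sum_(j < p) b j * (V^T *m x) j 0 ^+ 2.
Proof. by rewrite qform_diag; apply: eq_bigr => j _; rewrite mxE. Qed.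

(** Pythagoras: $1 - FF^T$ is a symmetric idempotent. *)
Lemma sqnorm_trmx_isometry_sub (R : rcfType) (p q : nat) (F : 'M[R]_(p, q))
  (y : 'cV[R]_p) : F^T *m F = 1%:M ->
  sqnorm (y - F *m (F^T *m y)) = sqnorm y - sqnorm (F^T *m y).
Proof.
move=> F1; have -> : y - F *m (F^T *m y) = (1%:M - F *m F^T) *m y.
  by rewrite mulmxBl mul1mx mulmxA.
rewrite !sqnorm_mul -[sqnorm y]qform1 -qformB trmxK; congr qform.
have -> : (1%:M - F *m F^T)^T = 1%:M - F *m F^T.
  by rewrite linearB /= trmx1 trmx_mul trmxK.
rewrite mulmxBl mul1mx mulmxBr mulmx1.
by rewrite mulmxA -[F *m F^T *m F]mulmxA F1 mulmx1 subrr subr0.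
Qed.

Lemma sqnorm_trmx_isometry (R : rcfType) (p q : nat) (F : 'M[R]_(p, q))
  (y : 'cV[R]_p) : F^T *m F = 1%:M -> sqnorm (F^T *m y) <= sqnorm y.
Proof.
by move=> F1; rewrite -subr_ge0 -sqnorm_trmx_isometry_sub // sqnorm_ge0.
Qed.

(** * Variational bounds for eigenvalues *)

Lemma notunit_kernel (R : fieldType) (p : nat) (G : 'M[R]_p) :
  G \notin unitmx -> exists2 x : 'cV[R]_p, x != 0 & G *m x = 0.
Proof.
move=> G_sing; have /rowV0Pn[v /sub_kermxP vG v_neq0] : kermx G^T != 0.
  by rewrite kermx_eq0 row_free_unit unitmx_tr.
exists v^T; last by rewrite -[G]trmxK -trmx_mul vG trmx0.
by apply: contra v_neq0 => /eqP/(congr1 trmx); rewrite trmxK trmx0 => ->.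
Qed.

(** Coordinate [i] itself may be nonzero, so for $i < k$ this subspace has dimension $i + 1$. *)
Definition supported_upto {R : rcfType} {k : nat} (i : nat) (x : 'cV[R]_k) : Prop :=
  forall j : 'I_k, (i < j)%N -> x j 0 = 0.

(* Courant-Fischer: the image under [F] of the vectors supported on the first
   [i + 1] coordinates meets the orthogonal complement of the first [i]
   eigenvectors. *)
Lemma courant_fischer_ge (R : rcfType) (p k : nat) (hkp : (k <= p)%N)
  (V : 'M[R]_p) (b : nat -> R) (F : 'M[R]_(p, k)) (i : nat) (c : R) :
  (i < k)%N -> V^T *m V = 1%:M ->
  (forall i j, (i <= j)%N -> (j < p)%N -> b j <= b i) ->
  F^T *m F = 1%:M ->
  (forall x, supported_upto i x ->
     c * sqnorm x <= qform (V *m diag_mx (\row_(j < p) b j) *m V^T) (F *m x)) ->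
  c <= b i.
Proof.
move=> lt_ik V1 b_dec F1 qF.
(* The first [i] rows express orthogonality of $Fx$ to the first [i] eigenvectors, and the rows
   after [i] express the support condition. Row [i] is zero, so [G] is singular and a nonzero kernel
   vector meets both demands. *)
pose G : 'M[R]_k := \matrix_(j, l)
  if (j < i)%N then (V^T *m F) (widen_ord hkp j) l
  else if (i < j)%N then (j == l)%:R else 0.
have [|x x_neq0 Gx] := @notunit_kernel _ _ G.
  apply/negP => /mulmxV/matrixP/(_ (Ordinal lt_ik) (Ordinal lt_ik)).
  rewrite !mxE eqxx big1.
    by move/esym/eqP; rewrite oner_eq0.
  by move=> l _; rewrite [G _ _]mxE /= ltnn mul0r.
have x_supp : supported_upto i x.
  move=> j lt_ij; move/matrixP: Gx => /(_ j 0); rewrite !mxE (bigD1 j) //=.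
  rewrite !mxE lt_ij ltnNge ltnW // eqxx mul1r big1 ?addr0 // => l l_neq.
  by rewrite !mxE lt_ij ltnNge ltnW //= eq_sym (negPf l_neq) mul0r.
have y0 (j : 'I_p) : (j < i)%N -> (V^T *m (F *m x)) j 0 = 0.
  move=> lt_ji; have lt_jk := ltn_trans lt_ji lt_ik.
  have <- : (G *m x) (Ordinal lt_jk) 0 = 0 by rewrite Gx mxE.
  rewrite mulmxA [LHS]mxE [RHS]mxE; apply: eq_bigr => l _.
  by rewrite [G _ _]mxE /= lt_ji; congr ((_ *m _) _ _ * _); apply: val_inj.
have x_gt0 : 0 < sqnorm x by apply: sum_sqr_gt0.
rewrite -(ler_pM2r x_gt0); apply: le_trans (qF _ x_supp) _.
have V1' : V^T^T *m V^T = 1%:M by rewrite trmxK; apply: mulmx1C.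
(* Only eigenvalues of index at least [i] contribute to the form at $Fx$, and each is at most
   [b i]. *)
rewrite qform_spectral -(sqnorm_isometry _ _ _ _ x F1).
rewrite -(sqnorm_isometry _ _ _ _ (F *m x) V1') sqnormE mulr_sumr.
apply: ler_sum => j _; have [/y0->|le_ij] := ltnP j i.
  by rewrite expr0n /= !mulr0.
by rewrite ler_wpM2r ?sqr_ge0 // b_dec.
Qed.

Lemma ler_sum_supported (R : rcfType) (k i : nat) (b : nat -> R) (x : 'cV[R]_k) :
  (forall j, (j <= i)%N -> b i <= b j) -> supported_upto i x ->
  b i * sqnorm x <= \sum_(j < k) b j * x j 0 ^+ 2.
Proof.
move=> b_dec x_supp; rewrite sqnormE mulr_sumr; apply: ler_sum => j _.
have [le_ji|/x_supp->] := leqP j i; last by rewrite expr0n /= !mulr0.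
by rewrite ler_wpM2r ?sqr_ge0 // b_dec.
Qed.

(** The trial subspace is the image under [F] of the leading $i + 1$ eigenvectors of [C], on which
    the form of [C] is at least [eigval C i] times the squared norm. *)
Lemma eigval_le_compression (R : rcfType) (p k : nat) (hkp : (k <= p)%N)
  (V : 'M[R]_p) (b : nat -> R) (F : 'M[R]_(p, k)) (C : 'M[R]_k) (i : nat) :
  (i < k)%N -> V^T *m V = 1%:M ->
  (forall i j, (i <= j)%N -> (j < p)%N -> b j <= b i) ->
  F^T *m F = 1%:M -> C^T = C ->
  (forall x, qform C x <=
             qform (V *m diag_mx (\row_(j < p) b j) *m V^T) (F *m x)) ->
  eigval C i <= b i.
Proof.
move=> lt_ik V1 b_dec F1 C_sym leCB.
have [W [W1 CE C_dec]] := eigval_spectral _ _ _ C_sym.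
apply: (courant_fischer_ge _ _ _ hkp _ _ (F *m W) _ _ lt_ik V1 b_dec).
  by rewrite trmx_mul mulmxA -[W^T *m F^T *m F]mulmxA F1 mulmx1.
move=> x x_supp; rewrite -[F *m W *m x]mulmxA; apply: le_trans (leCB _).
rewrite {2}CE qform_spectral mulmxA W1 mul1mx.
apply: ler_sum_supported x_supp => j le_ji.
exact: C_dec.
Qed.

Lemma specnorm_le1 (R : rcfType) (p k : nat) (B : 'M[R]_(p, k)) (x : 'cV[R]_k) :
  specnorm B <= 1 -> sqnorm (B *m x) <= sqnorm x.
Proof.
case: k B x => [|k] B x.
  by move=> _; rewrite !sqnormE big_ord0 big1 // => j _; rewrite mxE big_ord0 expr0n.
have H_sym : (B^T *m B)^T = B^T *m B by rewrite trmx_mul trmxK.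
rewrite /specnorm /singval -[1]sqrtr1 ler_sqrt // => H_le1.
have [V [V1 HE H_dec]] := eigval_spectral _ _ _ H_sym.
have V1' : V^T^T *m V^T = 1%:M by rewrite trmxK; apply: mulmx1C.
rewrite sqnorm_mul HE qform_spectral -(sqnorm_isometry _ _ _ _ x V1') sqnormE.
apply: ler_sum => j _; rewrite -[leRHS]mul1r ler_wpM2r ?sqr_ge0 //.
by apply: le_trans H_le1; apply: H_dec.
Qed.

(** * The Moore-Penrose pseudoinverse of a symmetric matrix *)

(** $BX$ and $BY$ are both the orthogonal projection onto the range of $B$, so they agree; likewise
    $XB = YB$. Then $X = XBX = YBX = YBY = Y$. *)
Lemma is_pinv_unique (R : rcfType) (p q : nat) (B : 'M[R]_(p, q))
  (X Y : 'M[R]_(q, p)) : is_pinv B X -> is_pinv B Y -> X = Y.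
Proof.
move=> [BXB XBX BX_sym XB_sym] [BYB YBY BY_sym YB_sym].
have BXY : B *m X = B *m Y.
  rewrite -[LHS]BX_sym -{1}BYB -!mulmxA mulmxA trmx_mul BX_sym BY_sym.
  by rewrite mulmxA BXB.
have XYB : X *m B = Y *m B.
  rewrite -[LHS]XB_sym -{1}BYB -mulmxA mulmxA trmx_mul [(Y *m B)^T]YB_sym.
  by rewrite XB_sym -mulmxA [B *m (X *m B)]mulmxA BXB.
by rewrite -XBX XYB -mulmxA BXY mulmxA YBY.
Qed.

(** Existence comes from inverting the eigenvalues, with the convention $0^{-1} = 0$. Symmetry
    follows from uniqueness, since the transpose satisfies the same four equations. *)
Lemma mpinv_sym (R : rcfType) (p : nat) (K : 'M[R]_p) :
  K^T = K -> is_pinv K (mpinv K) /\ (mpinv K)^T = mpinv K.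
Proof.
move=> K_sym; have [W [d [W1 KE]]] := sym_spectral _ _ _ K_sym.
have mulW (a b : 'rV[R]_p) :
    (W *m diag_mx a *m W^T) *m (W *m diag_mx b *m W^T) =
    W *m diag_mx (\row_j (a 0 j * b 0 j)) *m W^T.
  rewrite -!mulmxA [W^T *m (W *m _)]mulmxA W1 mul1mx.
  rewrite [diag_mx a *m (diag_mx b *m _)]mulmxA; congr (W *m (_ *m _)).
  apply/matrixP => i j; rewrite mul_diag_mx !mxE.
  by case: eqP => [->|_]; rewrite ?mulr1n ?mulr0n ?mulr0.
have symW (a : 'rV[R]_p) : (W *m diag_mx a *m W^T)^T = W *m diag_mx a *m W^T.
  by rewrite !trmx_mul trmxK tr_diag_mx mulmxA.
have K_pinv : is_pinv K (mpinv K).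
  apply: epsilon_spec; exists (W *m diag_mx (\row_j (d 0 j)^-1) *m W^T).
  split; rewrite KE ?mulW ?symW //; congr (_ *m diag_mx _ *m _);
    apply/rowP => j; rewrite !mxE.
    by have [->|d_neq0] := eqVneq (d 0 j) 0; rewrite ?mul0r // divff // mul1r.
  have [->|d_neq0] := eqVneq (d 0 j) 0; rewrite ?invr0 ?mulr0 //.
  by rewrite mulVf // mul1r.
split=> //; have [KXK XKX KX_sym XK_sym] := K_pinv.
apply: is_pinv_unique K_pinv; split.
- by rewrite -[K in RHS]K_sym -[in RHS]KXK !trmx_mul K_sym mulmxA.
- by rewrite -[in RHS]XKX !trmx_mul K_sym mulmxA.
- by rewrite trmx_mul trmxK K_sym -XK_sym trmx_mul K_sym.
- by rewrite trmx_mul trmxK K_sym -KX_sym trmx_mul K_sym.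
Qed.

(** * The Nyström approximation as a best approximation in the A-seminorm *)

Lemma qformD (R : rcfType) (p : nat) (A : 'M[R]_p) (x y : 'cV[R]_p) :
  A^T = A -> qform A (x + y) = qform A x + (y^T *m (A *m x)) 0 0 *+ 2 + qform A y.
Proof.
move=> A_sym; have xAy : (x^T *m A *m y) 0 0 = (y^T *m (A *m x)) 0 0.
  have -> : y^T *m (A *m x) = (x^T *m A *m y)^T by rewrite !trmx_mul trmxK A_sym.
  by rewrite [RHS]mxE.
rewrite /qform; have -> : (x + y)^T = x^T + y^T by rewrite linearD.
rewrite mulmxDr !mulmxDl -mulmxA -[y^T *m A *m x]mulmxA mulmxA -xAy.
move: xAy; set a := x^T *m A *m x; set b := x^T *m A *m y.
set c := y^T *m (A *m x); set d := y^T *m A *m y; clearbody a b c d.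
by rewrite !mxE => ->; ring.
Qed.

(** A vanishing sum of nonnegative terms $b_j y_j^2$ forces every $b_j y_j = 0$. *)
Lemma diag_form_kernel (R : rcfType) (p : nat) (V : 'M[R]_p) (b : nat -> R)
  (x : 'cV[R]_p) :
  V^T *m V = 1%:M -> (forall j, (j < p)%N -> 0 <= b j) ->
  qform (V *m diag_mx (\row_(j < p) b j) *m V^T) x = 0 ->
  V *m diag_mx (\row_(j < p) b j) *m V^T *m x = 0.
Proof.
move=> V1 b_ge0; rewrite qform_spectral => /eqP; rewrite psumr_eq0; last first.
  by move=> j _; rewrite mulr_ge0 ?sqr_ge0 ?b_ge0.
move=> /allP bx0; rewrite -mulmxA -mulmxA.
have -> : diag_mx (\row_(j < p) b j) *m (V^T *m x) = 0; last by rewrite mulmx0.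
apply/matrixP => i j; rewrite ord1 mul_diag_mx mxE [in RHS]mxE [X in X * _]mxE.
have := bx0 i (mem_index_enum i).
by rewrite mulf_eq0 sqrf_eq0 -mulf_eq0 => /eqP.
Qed.

Section Nystrom.

Variables (R : rcfType) (n k : nat) (A : 'M[R]_n) (Q : 'M[R]_(n, k)).
Hypothesis A_sym : A^T = A.
Hypothesis A_psd : forall x : 'cV[R]_n, 0 <= qform A x.
Hypothesis A_ker : forall x : 'cV[R]_n, qform A x = 0 -> A *m x = 0.

Let K := Q^T *m A *m Q.
Let P := A *m Q.
Let X := mpinv K.

Let PT : P^T = Q^T *m A.
Proof. by rewrite /P trmx_mul A_sym. Qed.

Let K_sym : K^T = K.
Proof. by rewrite /K !trmx_mul trmxK A_sym mulmxA. Qed.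

Definition nystrom : 'M[R]_n := P *m X *m P^T.

Lemma nystrom_sym : nystrom^T = nystrom.
Proof.
have X_sym : X^T = X by have [] := mpinv_sym _ _ _ K_sym.
by rewrite /nystrom trmx_mul trmxK trmx_mul X_sym mulmxA.
Qed.

(* [Q X P^T] is the A-orthogonal projection onto the range of [Q]. *)
Lemma qform_nystrom_residual (x : 'cV[R]_n) :
  qform A (x - Q *m (X *m (P^T *m x))) = qform A x - qform nystrom x.
Proof.
have [[KXK XKX _ _] X_sym] := mpinv_sym _ _ _ K_sym; rewrite -/X in KXK XKX X_sym.
have -> : x - Q *m (X *m (P^T *m x)) = (1%:M - Q *m X *m P^T) *m x.
  by rewrite mulmxBl mul1mx !mulmxA.
rewrite qform_mul -qformB; congr qform.
have -> : (1%:M - Q *m X *m P^T)^T = 1%:M - P *m X *m Q^T.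
  by rewrite linearB /= trmx1 trmx_mul trmxK trmx_mul X_sym mulmxA.
have -> : (1%:M - P *m X *m Q^T) *m A = A - nystrom.
  by rewrite mulmxBl mul1mx -[_ *m Q^T *m A]mulmxA -PT.
rewrite mulmxBr mulmx1 -[RHS]subr0; congr (_ - _).
have PTQ : P^T *m Q = K by rewrite PT.
(* The product vanishes because $XKX = X$, leaving only [A - nystrom]. *)
have -> : (A - nystrom) *m (Q *m X *m P^T) = nystrom - P *m (X *m K *m X) *m P^T.
  by rewrite mulmxBl /nystrom !mulmxA -[P *m X *m P^T *m Q]mulmxA PTQ /K !mulmxA.
by rewrite XKX subrr.
Qed.

Lemma qform_nystrom_le (x : 'cV[R]_n) : qform nystrom x <= qform A x.
Proof. by rewrite -subr_ge0 -qform_nystrom_residual A_psd. Qed.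

(** The residual $e = x - QXP^Tx$ satisfies $Q^TAe = 0$. Any other residual is $e + Qf$, so the
    cross term drops out and $e$ has the smallest A-form. *)
Lemma qform_nystrom_ge (x : 'cV[R]_n) (z : 'cV[R]_k) :
  qform A x - qform A (x - Q *m z) <= qform nystrom x.
Proof.
have [[KXK XKX KX_sym XK_sym] X_sym] := mpinv_sym _ _ _ K_sym.
rewrite -/X in KXK XKX KX_sym XK_sym X_sym.
(* As $K(1 - XK) = 0$, the A-form vanishes at [Q] times each column of $1 - XK$. Then [A] kills
   these vectors, which gives $P(1 - XK) = 0$. *)
have PXK : P *m (X *m K) = P.
  apply/eqP; rewrite eq_sym -subr_eq0; apply/eqP.
  rewrite -{1}[P]mulmx1 -mulmxBr; apply/matrixP => i j; rewrite [RHS]mxE.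
  have -> : (P *m (1%:M - X *m K)) i j =
      (A *m (Q *m col j (1%:M - X *m K))) i 0.
    by rewrite colE !mulmxA -colE [RHS]mxE.
  rewrite A_ker ?mxE // qform_mul /qform -mulmxA -/K.
  have -> : K *m col j (1%:M - X *m K) = 0.
    by rewrite colE mulmxA mulmxBr mulmx1 mulmxA KXK subrr mul0mx.
  by rewrite mulmx0 mxE.
rewrite lerBlDr addrC -lerBlDr -qform_nystrom_residual.
set e := x - _; set f := X *m (P^T *m x) - z.
have -> : x - Q *m z = e + Q *m f.
  by rewrite /e /f mulmxBr addrA subrK.
have Pe : P^T *m e = 0.
  have PTXK : K *m X *m P^T = P^T.
    by rewrite -[in RHS]PXK [RHS]trmx_mul [(X *m K)^T]trmx_mul X_sym K_sym.
  rewrite /e mulmxBr -{1}PTXK; apply/eqP; rewrite subr_eq0; apply/eqP.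
  by rewrite [in RHS]mulmxA PT /K !mulmxA.
rewrite qformD // trmx_mul -mulmxA [Q^T *m (A *m e)]mulmxA -PT Pe mulmx0 mxE.
by rewrite mul0rn addr0 lerDl A_psd.
Qed.

End Nystrom.

(** * Near-isometries and the splitting into leading and trailing coordinates *)

Lemma big_ord_shift (R : nmodType) (n k : nat) (hk : (k <= n)%N) (f : 'I_n -> R) :
  \sum_(j < n) f j =
  \sum_(j < k) f (widen_ord hk j) + \sum_(j < n - k) f (shift_ord j).
Proof.
rewrite (reindex (cast_ord (subnKC hk))) /=; last first.
  by exists (cast_ord (esym (subnKC hk))) => j _; rewrite ?cast_ordK ?cast_ordKV.
rewrite big_split_ord /=.
by congr (_ + _); apply: eq_bigr => j _; congr f; apply: val_inj.
Qed.

(* On a square matrix the bounds transfer from [G^T G] to [G G^T], which has the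
   same spectrum. *)
Lemma near_isometry_tr (R : rcfType) (k : nat) (G : 'M[R]_k) (t : R) (a : 'cV[R]_k) :
  t < 1 ->
  (forall x, (1 - t) * sqnorm x <= sqnorm (G *m x)) ->
  (forall x, sqnorm (G *m x) <= sqnorm x) ->
  sqnorm a - sqnorm (G^T *m a) <= t * sqnorm a /\
  sqnorm (a - G *m (G^T *m a)) <= t ^+ 2 * sqnorm a.
Proof.
move=> t_lt1 G_ge G_le.
have G_unit : G \in unitmx.
  apply: contraT => /notunit_kernel[x x_neq0 Gx0].
  have x_gt0 : 0 < sqnorm x by apply: sum_sqr_gt0.
  have := G_ge x; rewrite Gx0 [sqnorm 0]/sqnorm mulmx0 mxE.
  by rewrite leNgt pmulr_lgt0 // subr_gt0 t_lt1.
have S_sym : (G *m G^T)^T = G *m G^T by rewrite trmx_mul trmxK.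
have [V [s [V1 SE]]] := sym_spectral _ _ _ S_sym.
have VT1 : V^T^T *m V^T = 1%:M by rewrite trmxK; apply: mulmx1C.
(* For a unit eigenvector $v$ of $GG^T$ with eigenvalue $s$, the vector $y = G^Tv$ has $|y|^2 = s$
   and $|Gy|^2 = s^2$. The hypotheses at $y$ read $(1-t)s \le s^2 \le s$, and $s > 0$ because $G$ is
   invertible. *)
have s_bounds j : 1 - t <= s 0 j <= 1.
  have v1 : sqnorm (col j V) = 1.
    move/matrixP: V1 => /(_ j j); rewrite !mxE eqxx sqnormE => V1j.
    by apply: etrans V1j; apply: eq_bigr => l _; rewrite !mxE expr2.
  pose y := G^T *m col j V.
  have Gy : G *m y = s 0 j *: col j V.
    rewrite /y mulmxA SE colE -!mulmxA [V^T *m _]mulmxA V1 mul1mx.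
    rewrite scalemxAr; congr (V *m _).
    apply/matrixP => l q; rewrite mul_diag_mx !mxE.
    by case: (l =P j) => [->//|_]; rewrite !mulr0.
  have y_norm : sqnorm y = s 0 j.
    rewrite /y sqnorm_mul trmxK /qform -mulmxA -[G *m G^T *m _]mulmxA Gy.
    by rewrite -scalemxAr mxE -/(sqnorm _) v1 mulr1.
  have y_gt0 : 0 < s 0 j.
    rewrite -y_norm; apply: sum_sqr_gt0; apply/eqP => y0.
    have v0 : col j V = 0.
      have GT_unit : G^T \in unitmx by rewrite unitmx_tr.
      by rewrite -[LHS](mulKmx GT_unit) -/y y0 mulmx0.
    by move: v1; rewrite v0 /sqnorm mulmx0 mxE => /eqP; rewrite eq_sym oner_eq0.
  have Gy_norm : sqnorm (G *m y) = s 0 j * s 0 j.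
    rewrite Gy /sqnorm -scalemxAr mxE.
    have -> : (s 0 j *: col j V)^T = s 0 j *: (col j V)^T by rewrite linearZ.
    by rewrite -scalemxAl mxE -/(sqnorm _) v1 mulr1.
  have := G_ge y; have := G_le y; rewrite Gy_norm y_norm.
  by rewrite ler_pM2r // -[leRHS]mul1r ler_pM2r // => -> ->.
pose b := V^T *m a.
have a_norm : sqnorm a = sqnorm b by rewrite sqnorm_isometry.
have aE : a = V *m b by rewrite mulmxA (mulmx1C V1) mul1mx.
have GTa : sqnorm (G^T *m a) = \sum_(j < k) s 0 j * b j 0 ^+ 2.
  by rewrite sqnorm_mul trmxK SE qform_diag.
(* In the eigenbasis both claims hold coordinatewise, from $1 - s_j \le t$ and $(1 - s_j)^2 \le
   t^2$. *)
split.
  rewrite GTa a_norm sqnormE -sumrB mulr_sumr; apply: ler_sum => j _.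
  have /andP[s_ge _] := s_bounds j.
  by rewrite -[X in X - _]mul1r -mulrBl ler_wpM2r ?sqr_ge0 // lerBlDr addrC -lerBlDr.
have -> : a - G *m (G^T *m a) = V *m (b - diag_mx s *m b).
  by rewrite mulmxBr -aE mulmxA SE /b !mulmxA.
rewrite sqnorm_isometry // a_norm !sqnormE mulr_sumr; apply: ler_sum => j _.
have /andP[s_ge s_le] := s_bounds j.
have -> : (b - diag_mx s *m b) j 0 = (1 - s 0 j) * b j 0.
  by rewrite mul_diag_mx !mxE mulrBl mul1r.
rewrite exprMn ler_wpM2r ?sqr_ge0 // ler_sqr ?nnegrE; lra.
Qed.

Lemma trmx_colsub_mul (R : rcfType) (n p q : nat) (f : 'I_p -> 'I_n) (U : 'M[R]_n)
  (B : 'M[R]_(n, q)) (i : 'I_p) (j : 'I_q) :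
  ((colsub f U)^T *m B) i j = (U^T *m B) (f i) j.
Proof. by rewrite !mxE; apply: eq_bigr => l _; rewrite !mxE. Qed.

Lemma trmx_colsub_mul_colsub (R : rcfType) (n p q : nat) (f : 'I_p -> 'I_n)
  (g : 'I_q -> 'I_n) (U : 'M[R]_n) : U^T *m U = 1%:M ->
  (colsub f U)^T *m colsub g U = \matrix_(i, j) (f i == g j)%:R.
Proof.
move=> U1; apply/matrixP => i j; rewrite trmx_colsub_mul [RHS]mxE.
move/matrixP: U1 => /(_ (f i) (g j)); rewrite !mxE => <-.
by apply: eq_bigr => l _; rewrite !mxE.
Qed.

Lemma sqnormZ (R : rcfType) (p : nat) (a : R) (x : 'cV[R]_p) :
  sqnorm (a *: x) = a ^+ 2 * sqnorm x.
Proof.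
by rewrite !sqnormE mulr_sumr; apply: eq_bigr => j _; rewrite mxE exprMn.
Qed.

(* Indices are 0-based: lam j stands for lambda_{j+1}; i ranges over 0..k-1. *)
Theorem theorem3p2 (R : rcfType) (n k : nat) (hk1 : (1 <= k)%N) (hkn : (k < n)%N)
  (A U : 'M[R]_n) (lam : nat -> R)
  (A_sym : A^T = A)
  (A_psd : forall x : 'cV[R]_n, 0 <= (x^T *m A *m x) 0 0)
  (U_orth : U^T *m U = 1%:M)
  (A_eig : A = U *m diag_mx (\row_(j < n) lam j) *m U^T)
  (lam_dec : forall i j, (i <= j)%N -> (j < n)%N -> lam j <= lam i)
  (lam_nneg : forall j, (j < n)%N -> 0 <= lam j)
  (eps : R) (eps_ge0 : 0 <= eps) (eps_lt1 : eps < 1)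
  (Q : 'M[R]_(n, k)) (M : 'M[R]_k) (N : 'M[R]_(n - k, k))
  (Q_orth : Q^T *m Q = 1%:M)
  (Q_eq : Q = firstcols (ltnW hkn) U + eps ^+ 2 *: (firstcols (ltnW hkn) U *m M)
              + eps *: (lastcols k U *m N))
  (M_norm : specnorm M <= 1) (N_norm : specnorm N <= 1)
  (i : nat) (hi : (i < k)%N) (lam_i_pos : 0 < lam i) :
  let alpha := 1 - (3 * lam k + 3 * eps ^+ 2 * (lam 0%N - lam k)) / lam i in
  let C_RR := 2 + eps ^+ 2 + lam k / lam 0%N in
  let C_Nys := ((lam 0%N * (1 + eps ^+ 2)
                 + lam k * (1 + eps ^+ 2 / (1 + Num.sqrt (1 - eps ^+ 2))))
                / (alpha * lam i)) ^+ 2 in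
  0 < alpha ->
  [/\ C_RR <= 4,
      `|lam i - singval (A *m Q) i| <= `|lam i - eigval (Q^T *m A *m Q) i|,
      `|lam i - eigval (Q^T *m A *m Q) i| <= C_RR * eps ^+ 2 * lam 0%N
    & `|lam i - eigval ((A *m Q) *m mpinv (Q^T *m A *m Q) *m (A *m Q)^T) i|
        <= C_Nys * (eps ^+ 2 * lam k + eps ^+ 4 * (lam 0%N - lam k))].
Proof.
move=> alpha C_RR C_Nys alpha_gt0.
have lt_0n : (0 < n)%N by apply: (leq_ltn_trans _ hkn).
have lt_in : (i < n)%N by apply: (ltn_trans _ hkn).
have lam0_ge : lam i <= lam 0%N by apply: lam_dec.
have lamk_le : lam k <= lam 0%N by apply: lam_dec.
have lamk_ge0 : 0 <= lam k by apply: lam_nneg.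
have lam0_gt0 : 0 < lam 0%N by apply: lt_le_trans lam0_ge.
have lam0_ge0 := ltW lam0_gt0; have lami_ge0 := ltW lam_i_pos.
have eps2_ge0 : 0 <= eps ^+ 2 by apply: sqr_ge0.
have eps2_lt1 : eps ^+ 2 < 1 by rewrite expr_lt1.
have lam_dec_i j : (j <= i)%N -> lam i <= lam j by move=> le_ji; apply: lam_dec.

(* The form of A in the coordinates of its eigenvectors *)
have qA x : qform A x = \sum_(j < n) lam j * (U^T *m x) j 0 ^+ 2.
  by rewrite A_eig qform_spectral.
pose U1 := firstcols (ltnW hkn) U; pose U2 := lastcols k U.
have U1U1 : U1^T *m U1 = 1%:M.
  rewrite trmx_colsub_mul_colsub //; apply/matrixP => l j; rewrite !mxE.
  by rewrite (inj_eq (f := widen_ord _)) // => ? ? /(congr1 val)/= /val_inj.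
have U2U2 : U2^T *m U2 = 1%:M.
  rewrite trmx_colsub_mul_colsub //; apply/matrixP => l j; rewrite !mxE.
  by rewrite (inj_eq (f := @shift_ord n k)) // => ? ? /(congr1 val)/= /addnI/val_inj.
have U1U2 : U1^T *m U2 = 0.
  rewrite trmx_colsub_mul_colsub //; apply/matrixP => l j; rewrite !mxE.
  case: eqP => // /(congr1 val) /= le_lj.
  by have := ltn_ord l; rewrite le_lj ltnNge leq_addr.
have U2U1 : U2^T *m U1 = 0 by rewrite -[LHS]trmxK trmx_mul trmxK U1U2 trmx0.
have U1E x j : (U1^T *m x) j 0 = (U^T *m x) (widen_ord (ltnW hkn) j) 0.
  exact: trmx_colsub_mul.
have U2E x j : (U2^T *m x) j 0 = (U^T *m x) (shift_ord j) 0.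
  exact: trmx_colsub_mul.
have UT1 : U^T^T *m U^T = 1%:M by rewrite trmxK; apply: mulmx1C.
have sqnorm_split x : sqnorm x = sqnorm (U1^T *m x) + sqnorm (U2^T *m x).
  rewrite -(sqnorm_isometry _ _ _ _ x UT1) !sqnormE (big_ord_shift _ _ _ (ltnW hkn)).
  by congr (_ + _); apply: eq_bigr => j _; rewrite ?U1E ?U2E.
have qA_ge x : \sum_(j < k) lam j * (U1^T *m x) j 0 ^+ 2 <= qform A x.
  rewrite qA (big_ord_shift _ _ _ (ltnW hkn)) /=.
  under eq_bigr do rewrite U1E.
  by rewrite lerDl sumr_ge0 // => j _; rewrite mulr_ge0 ?sqr_ge0 ?lam_nneg ?shift_ord_proof.
(* Eigenvalues are bounded by [lam 0] on the range of [U1] and by [lam k] on that of [U2]. In this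
   form the total norm and the leading component can be estimated separately. *)
have qA_le x :
    qform A x <= lam k * sqnorm x + (lam 0%N - lam k) * sqnorm (U1^T *m x).
  have -> : lam k * sqnorm x + (lam 0%N - lam k) * sqnorm (U1^T *m x) =
      lam 0%N * sqnorm (U1^T *m x) + lam k * sqnorm (U2^T *m x).
    by rewrite sqnorm_split; ring.
  rewrite qA (big_ord_shift _ _ _ (ltnW hkn)) !sqnormE !mulr_sumr.
  apply: lerD; apply: ler_sum => j _; rewrite ?U1E ?U2E ler_wpM2r ?sqr_ge0 //.
    by apply: lam_dec => //; apply: (ltn_trans _ hkn); apply: ltn_ord.
  by apply: lam_dec; rewrite ?leq_addr // shift_ord_proof.
pose Q1 := U1^T *m Q.
have Q1E : Q1 = 1%:M + eps ^+ 2 *: M.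
  rewrite /Q1 Q_eq -/U1 -/U2 !mulmxDr -!scalemxAr !mulmxA U1U1 U1U2 mul1mx.
  by rewrite mul0mx scaler0 addr0.
have Q2E : U2^T *m Q = eps *: N.
  rewrite Q_eq -/U1 -/U2 !mulmxDr -!scalemxAr !mulmxA U2U1 U2U2 mul1mx.
  by rewrite mul0mx scaler0 !add0r.

(* Rayleigh-Ritz values and singular values *)
pose K := Q^T *m A *m Q.
have K_sym : K^T = K by rewrite /K !trmx_mul trmxK A_sym mulmxA.
pose S := (A *m Q)^T *m (A *m Q).
have S_sym : S^T = S by rewrite /S trmx_mul trmxK.
have [W [W1 KE K_dec]] := eigval_spectral _ _ _ K_sym.
have ritz_le : eigval K i <= lam i.
  apply: (eigval_le_compression _ _ _ (ltnW hkn) _ _ _ _ _ hi U_orth lam_dec Q_orth K_sym).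
  by move=> x; rewrite -A_eig qform_mul.
have svd_le : singval (A *m Q) i <= lam i.
  (* After squaring, $Q^TA^2Q$ is a compression of $A^2$, whose eigenvalues are $\lambda_j^2$. *)
  rewrite /singval -/S -[leRHS]ger0_norm ?lam_nneg // -sqrtr_sqr ler_wsqrtr //.
  apply: (eigval_le_compression _ _ _ (ltnW hkn) U (fun j => lam j ^+ 2) Q _ _ hi
    U_orth _ Q_orth S_sym).
    move=> l j le_lj lt_jn; rewrite ler_sqr ?nnegrE ?lam_nneg ?lam_dec //.
    exact: leq_ltn_trans lt_jn.
  move=> x; rewrite -sqnorm_mul -mulmxA sqnorm_mul A_sym.
  have -> : A *m A = U *m diag_mx (\row_(j < n) (fun j => lam j ^+ 2) j) *m U^T.
    rewrite {1 2}A_eig -!mulmxA [U^T *m (U *m _)]mulmxA U_orth mul1mx.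
    rewrite [diag_mx _ *m (diag_mx _ *m _)]mulmxA; congr (_ *m (_ *m _)).
    apply/matrixP => l j; rewrite mul_diag_mx !mxE.
    by case: (l =P j) => [->|_]; rewrite ?mulr1n ?mulr0n ?mulr0 // expr2.
  by [].
have qW x : qform K (W *m x) = \sum_(j < k) eigval K j * x j 0 ^+ 2.
  by rewrite {1}KE qform_spectral mulmxA W1 mul1mx.
have ritz_ge0 j : (j < k)%N -> 0 <= eigval K j.
  move=> lt_jk; pose e : 'cV[R]_k := delta_mx (Ordinal lt_jk) 0.
  have -> : eigval K j = qform A (Q *m (W *m e)).
    rewrite qform_mul -/K qW (bigD1 (Ordinal lt_jk)) //= big1.
      by rewrite mxE !eqxx expr1n mulr1 addr0.
    by move=> l /negPf l_neq; rewrite mxE l_neq expr0n mulr0.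
  exact: A_psd.
have ritz_le_svd : eigval K i <= singval (A *m Q) i.
  rewrite /singval -/S -[leLHS]ger0_norm ?ritz_ge0 // -sqrtr_sqr ler_wsqrtr //.
  have [Z [Z1 SE S_dec]] := eigval_spectral _ _ _ S_sym.
  (* On the leading Ritz vectors, $|AQWx|^2 \ge |Q^TAQWx|^2$, and the right side is the sum of the
     squared Ritz values times $x_j^2$. *)
  apply: (courant_fischer_ge _ _ _ (leqnn k) Z _ W _ _ hi Z1 S_dec W1).
  move=> x x_supp; rewrite -SE -sqnorm_mul.
  apply: le_trans (sqnorm_trmx_isometry _ _ _ _ _ Q_orth).
  have -> : Q^T *m (A *m Q *m (W *m x)) = W *m (diag_mx (\row_j eigval K j) *m x).
    transitivity (K *m (W *m x)); first by rewrite /K !mulmxA.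
    by rewrite {1}KE -!mulmxA [W^T *m (W *m x)]mulmxA W1 mul1mx.
  rewrite sqnorm_isometry // [leRHS]sqnormE.
  rewrite (eq_bigr (fun j : 'I_k => eigval K j ^+ 2 * x j 0 ^+ 2)); last first.
    by move=> j _; rewrite mul_diag_mx !mxE exprMn.
  apply: (ler_sum_supported _ _ _ (fun j => eigval K j ^+ 2)) x_supp => j le_ji.
  have lt_jk := leq_ltn_trans le_ji hi.
  by rewrite ler_sqr ?nnegrE ?ritz_ge0 ?K_dec.
have ritz_ge : lam i - 2 * eps ^+ 2 * lam 0%N <= eigval K i.
  apply: (courant_fischer_ge _ _ _ (leqnn k) W _ 1%:M _ _ hi W1 K_dec).
    by rewrite trmx1 mulmx1.
  move=> x x_supp; rewrite -KE mul1mx -qform_mul; apply: le_trans (qA_ge _).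
  rewrite mulmxA -/Q1 Q1E.
  pose y := M *m x.
  have y_le : sqnorm y <= sqnorm x by apply: specnorm_le1.
  (* The factor 2 in the error comes from $|x|^2 + |y|^2 \le 2|x|^2$, where $y = Mx$. *)
  apply: (@le_trans _ _ (\sum_(j < k) lam j * x j 0 ^+ 2
      - eps ^+ 2 * lam 0%N * (sqnorm x + sqnorm y))).
    have := ler_sum_supported _ _ _ _ _ lam_dec_i x_supp.
    have : 0 <= eps ^+ 2 * lam 0%N * (sqnorm x - sqnorm y).
      by rewrite mulr_ge0 ?subr_ge0 // mulr_ge0 // ltW.
    set T := \sum_(j < k) _; lra.
  rewrite !sqnormE -big_split /= mulr_sumr -sumrB; apply: ler_sum => j _.
  have -> : ((1%:M + eps ^+ 2 *: M) *m x) j 0 = x j 0 + eps ^+ 2 * y j 0.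
    by rewrite mulmxDl mul1mx -scalemxAl -/y !mxE.
  have lamj_ge0 : 0 <= lam j by apply: lam_nneg; apply: (ltn_trans _ hkn).
  have lamj_le : lam j <= lam 0%N by apply: lam_dec => //; apply: (ltn_trans _ hkn).
  (* The cross term $2xy$ is written as $(x+y)^2 - x^2 - y^2$, so that the squares with positive
     sign can be discarded. *)
  have eq1 : lam j * (x j 0 + eps ^+ 2 * y j 0) ^+ 2 =
    lam j * x j 0 ^+ 2 + eps ^+ 2 * lam j * ((x j 0 + y j 0) ^+ 2)
    - eps ^+ 2 * lam j * (x j 0 ^+ 2 + y j 0 ^+ 2) +
    lam j * (eps ^+ 2 * y j 0) ^+ 2 by ring.
  have p1 : 0 <= eps ^+ 2 * lam j * ((x j 0 + y j 0) ^+ 2).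
    by apply: mulr_ge0; rewrite ?sqr_ge0 // mulr_ge0.
  have p2 : 0 <= lam j * (eps ^+ 2 * y j 0) ^+ 2 by rewrite mulr_ge0 ?sqr_ge0.
  have p3 : 0 <= eps ^+ 2 * (lam 0%N - lam j) * (x j 0 ^+ 2 + y j 0 ^+ 2).
    by apply: mulr_ge0; [apply: mulr_ge0; rewrite ?subr_ge0 | rewrite addr_ge0 ?sqr_ge0].
  rewrite eq1; lra.

(* Nyström values *)
have A_ker x : qform A x = 0 -> A *m x = 0.
  by rewrite A_eig; apply: diag_form_kernel.
pose Y := nystrom _ _ _ A Q.
have Y_sym : Y^T = Y by apply: nystrom_sym.
have nys_le : eigval Y i <= lam i.
  apply: (eigval_le_compression _ _ _ (leqnn n) U lam 1%:M _ _ lt_in U_orth lam_dec _ Y_sym).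
    by rewrite trmx1 mulmx1.
  by move=> x; rewrite -A_eig mul1mx; apply: qform_nystrom_le.
have nys_ge : lam i - (eps ^+ 2 * lam k + eps ^+ 4 * (lam 0%N - lam k)) <= eigval Y i.
  have [Z [Z1 YE Y_dec]] := eigval_spectral _ _ _ Y_sym.
  apply: (courant_fischer_ge _ _ _ (ltnW hkn) Z _ U1 _ _ hi Z1 Y_dec U1U1).
  move=> x x_supp; rewrite -YE.
  (* Orthonormality of [Q] with $U_2^TQ = \epsilon N$ and $\|N\|_2 \le 1$ makes [Q1] a near-isometry
     with defect $t = \epsilon^2$. *)
  have Q_split y : sqnorm y = sqnorm (Q1 *m y) + eps ^+ 2 * sqnorm (N *m y).
    rewrite -(sqnorm_isometry _ _ _ _ y Q_orth) sqnorm_split !mulmxA Q2E.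
    by rewrite -scalemxAl sqnormZ.
  have [||r_le r1_le] := near_isometry_tr _ _ Q1 _ x eps2_lt1.
  - move=> y; have := Q_split y.
    have : eps ^+ 2 * sqnorm (N *m y) <= eps ^+ 2 * sqnorm y.
      by rewrite ler_wpM2l // specnorm_le1.
    lra.
  - by move=> y; rewrite [leRHS]Q_split lerDl mulr_ge0 // sqnorm_ge0.
  have QU1 : Q^T *m (U1 *m x) = Q1^T *m x by rewrite mulmxA /Q1 trmx_mul trmxK.
  apply: le_trans (qform_nystrom_ge _ _ _ A Q A_sym A_psd A_ker _ (Q^T *m (U1 *m x))).
  (* The whole residual contributes $\epsilon^2$ with weight $\lambda_{k+1}$; its component along
     [U1] contributes $\epsilon^4$ with weight $\lambda_1 - \lambda_{k+1}$. *)
  have := qA_le (U1 *m x - Q *m (Q^T *m (U1 *m x))).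
  have -> : U1^T *m (U1 *m x - Q *m (Q^T *m (U1 *m x))) = x - Q1 *m (Q1^T *m x).
    by rewrite QU1 mulmxBr !mulmxA U1U1 mul1mx.
  rewrite sqnorm_trmx_isometry_sub // QU1 sqnorm_isometry //.
  have qU1 : lam i * sqnorm x <= qform A (U1 *m x).
    apply: le_trans (qA_ge _); rewrite mulmxA U1U1 mul1mx.
    exact: ler_sum_supported.
  have m1 : lam k * (sqnorm x - sqnorm (Q1^T *m x)) <= lam k * (eps ^+ 2 * sqnorm x).
    by rewrite ler_wpM2l.
  have m2 : (lam 0%N - lam k) * sqnorm (x - Q1 *m (Q1^T *m x)) <=
      (lam 0%N - lam k) * (eps ^+ 4 * sqnorm x).
    by rewrite ler_wpM2l ?subr_ge0 // -[4%N]/(2 * 2)%N exprM.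
  lra.
have C_RR_le : 2 * eps ^+ 2 * lam 0%N <= C_RR * eps ^+ 2 * lam 0%N.
  do 2 (apply: ler_wpM2r => //).
  by rewrite /C_RR -addrA lerDl addr_ge0 ?divr_ge0.
(* As $\alpha_i \le 1$, the denominator is at most $\lambda_i \le \lambda_1$, which is at most the
   numerator. *)
have C_Nys_ge1 : 1 <= C_Nys.
  have den_gt0 : 0 < alpha * lam i by apply: mulr_gt0.
  have three_ge0 : 0 <= 3 :> R by apply: ler0n.
  have den_le : alpha * lam i <= lam i.
    rewrite -[leRHS]mul1r; apply: ler_wpM2r => //; rewrite /alpha gerBl divr_ge0 //.
    by rewrite addr_ge0 //; do 2 (rewrite ?mulr_ge0 ?subr_ge0 //).
  have num_ge : lam 0%N <= lam 0%N * (1 + eps ^+ 2)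
      + lam k * (1 + eps ^+ 2 / (1 + Num.sqrt (1 - eps ^+ 2))).
    have sqrt_ge0 : 0 <= Num.sqrt (1 - eps ^+ 2) by apply: sqrtr_ge0.
    rewrite mulrDr mulr1 -addrA lerDl; apply: addr_ge0; apply: mulr_ge0 => //.
    by apply: addr_ge0 => //; apply: divr_ge0 => //; apply: addr_ge0.
  rewrite /C_Nys exprn_ege1 // ler_pdivlMr // mul1r.
  exact: le_trans (le_trans den_le lam0_ge) num_ge.
have nys_err_ge0 : 0 <= eps ^+ 2 * lam k + eps ^+ 4 * (lam 0%N - lam k).
  by rewrite addr_ge0 ?mulr_ge0 ?subr_ge0 ?exprn_ge0.
(* All three estimates lie below $\lambda_i$, so every absolute value opens with a known sign. *)
split.
- rewrite /C_RR; have : lam k / lam 0%N <= 1 by rewrite ler_pdivrMr // mul1r.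
  lra.
- by rewrite !ger0_norm ?subr_ge0 // lerD2l lerN2.
- rewrite ger0_norm ?subr_ge0 //; apply: le_trans C_RR_le.
  by rewrite lerBlDl -lerBlDr.
- rewrite -[X in eigval X i]/Y ger0_norm ?subr_ge0 //.
  apply: (@le_trans _ _ (eps ^+ 2 * lam k + eps ^+ 4 * (lam 0%N - lam k))).
    by rewrite lerBlDl -lerBlDr.
  by rewrite -[leLHS]mul1r ler_wpM2r.
Qed.
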